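(* Let $m$ be a positive integer and let $\alpha=\{a_j\}_{j=1}^\infty$ be a sequence of strictly positive real numbers such that $L_1(\alpha;m)<\infty$. Let $A_N=\sum_{j=1}^Na_j$ and let $T_m(N)$ be the coupon-collector variable with coupon probabilities $p_j=a_j/A_N$, $1\le j\le N$. Then, for all $s\in[0,\infty)$, $$P\left\{\frac{T_m(N)}{A_N}\le s\right\}\to F(s):=\prod_{j=1}^\infty\left[1-S_m(a_js)e^{-a_js}\right],\qquad N\to\infty.$$
   Context: Coupon collector setting: coupons of $N$ types are drawn independently with replacement, type $j$ having probability $p_j>0$, $\sum_{j=1}^Np_j=1$. $T_m(N)$ is the number of draws needed until every one of the $N$ types has been drawn at least $m$ times. $S_m(y)=\sum_{l=0}^{m-1}\frac{y^l}{l!}$, and $$L_1(\alpha;m)=\int_0^1\Big\{1-\prod_{j=1}^\infty\big[1-x^{a_j}S_m(-a_j\ln x)\big]\Big\}\frac{dx}{x}=\int_0^\infty\Big\{1-\prod_{j=1}^\infty\big[1-e^{-a_jt}S_m(a_jt)\big]\Big\}dt\in(0,\infty].$$ *)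

(* Defs.v *)
From HB Require Import structures.
From mathcomp Require Import all_boot all_order all_algebra.
From mathcomp Require Import all_classical all_reals all_analysis.

Set Implicit Arguments.
Unset Strict Implicit.
Unset Printing Implicit Defensive.

Import Order.TTheory GRing.Theory Num.Theory.
Import numFieldNormedType.Exports.

Local Open Scope classical_set_scope.
Local Open Scope ring_scope.

(* Sequences indexed by j >= 1 on paper are indexed from 0 here: [a j] stands
   for a_{j+1}, and the N coupon types are the naturals j < N. *)

Definition partial_sum (R : realType) (a : nat -> R) (N : nat) : R :=
  \sum_(0 <= j < N) a j.

(* All the products below have factors in [0, 1], so the partial products are
   nonincreasing and nonnegative, and this limit exists. *)
Definition infinite_prod (R : realType) (f : nat -> R) : R :=
  lim ((\prod_(0 <= j < n) f j) @[n --> \oo]).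

Definition exp_sum (R : realType) (m : nat) (y : R) : R :=
  \sum_(0 <= l < m) y ^+ l / l`!%:R.

Definition L1 (R : realType) (a : nat -> R) (m : nat) : \bar R :=
  (\int[@lebesgue_measure R]_(x in `]0%R, 1%R[)
     ((1 - infinite_prod
             (fun j => 1 - x `^ (a j) * exp_sum m (- a j * ln x))) / x)%:E)%E.

Definition limit_cdf (R : realType) (a : nat -> R) (m : nat) (s : R) : R :=
  infinite_prod (fun j => 1 - exp_sum m (a j * s) * expR (- (a j * s))).

Definition mutually_independent d d' (Omega : measurableType d)
    (T : measurableType d') (R : realType) (P : probability Omega R)
    (X : nat -> {RV P >-> T}) : Prop :=
  forall (J : seq nat) (B : nat -> set T), uniq J ->
    (forall k, measurable (B k)) ->
    P (\bigcap_(k in [set` J]) (X k @^-1` B k)) =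
      (\prod_(k <- J) P (X k @^-1` B k))%E.

(* [X k] is the type of the (k+1)-st coupon drawn.  When the p j with j < N sum
   to 1, the condition on the law says that [X k] is almost surely < N. *)
Definition coupon_draws d (Omega : measurableType d) (R : realType)
    (P : probability Omega R) (N : nat) (p : nat -> R)
    (X : nat -> {RV P >-> nat}) : Prop :=
  mutually_independent X /\
  forall k j, (j < N)%N -> P (X k @^-1` [set j]) = (p j)%:E.

Definition times_drawn (x : nat -> nat) (j n : nat) : nat :=
  (\sum_(0 <= k < n) (x k == j))%N.

(* T_m(N) along the sequence of draws x; it is +oo (the infimum of the empty
   set) if some type j < N is drawn fewer than m times in all. *)
Definition collection_time (R : realType) (m N : nat) (x : nat -> nat) :
    \bar R :=
  ereal_inf [set n%:R%:E | n in
    [set n | forall j, (j < N)%N -> (m <= times_drawn x j n)%N]].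

(* Main.v *)
(* With n = floor (s A_N), the event T_m(N) / A_N <= s says that every type j < N
   occurs at least m times in the first n draws.  Finiteness of L_1 forces F(t) > 0
   for some t > 0 (otherwise the integrand would be 1/x), hence a_j > 1 eventually
   and A_N -> oo.  For K fixed types the counts are then multinomial with
   n p_j -> a_j s, so they converge to independent Poisson variables and the first
   K types are completed with probability tending to the partial product F_K(s);
   this gives limsup <= F(s).  For the lower bound only F(s) > 0 matters; then the
   Poisson tails u_j = S_m(a_j s) exp(- a_j s) are summable, and since
   P(Bin(n, p_j) < m) <= e^m u_j uniformly in N, the types j >= K contribute at
   most e^m times the tail of this series. *)
Require Import Defs.
From HB Require Import structures.
From mathcomp Require Import all_boot all_order all_algebra.
From mathcomp Require Import all_classical all_reals all_analysis.
From mathcomp Require Import measurable_realfun zify ring lra.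

Import Order.TTheory GRing.Theory Num.Theory.
Import numFieldNormedType.Exports.

Local Open Scope classical_set_scope.
Local Open Scope ring_scope.

(** * Finite additivity for probabilities read as real numbers *)

Lemma fine_measure_preimage_seq d (T : measurableType d) (R : realType)
    (P : probability T R) (S : set T) (f : T -> nat) (s : seq nat) :
  measurable S -> (forall c, measurable (f @^-1` [set c])) -> uniq s ->
  fine (P (S `&` [set w | f w \in s])) =
    \sum_(c <- s) fine (P (S `&` f @^-1` [set c])).
Proof.
move=> mS mf.
have ms (t : seq nat) : measurable [set w | f w \in t].
  elim: t => [|c t IH].
    have -> : [set w | f w \in [::]] = set0 by apply/seteqP; split.
    exact: measurable0.
  have -> : [set w | f w \in c :: t] = f @^-1` [set c] `|` [set w | f w \in t].
    apply/seteqP; split=> w /=; rewrite inE; first by move=> /orP[/eqP|]; [left|right].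
    by move=> [->|->]; rewrite ?eqxx ?orbT.
  exact: measurableU.
elim: s => [_|c s IH /= /andP[cs us]].
  have -> : [set w | f w \in [::]] = set0 by apply/seteqP; split.
  by rewrite big_nil setI0 measure0.
rewrite big_cons -IH// -fineD ?fin_num_measure//; try exact: measurableI.
rewrite -measureU; try exact: measurableI; last first.
  rewrite -setIIr (_ : f @^-1` [set c] `&` _ = set0) ?setI0//.
  by apply/seteqP; split=> // w /= [->]; rewrite (negbTE cs).
rewrite -setIUr; congr (fine (P (_ `&` _))); apply/seteqP; split=> w /=; rewrite inE.
  by move=> /orP[/eqP|]; [left|right].
by move=> [->|->]; rewrite ?eqxx ?orbT.
Qed.

Lemma fine_measure_setIC d (T : measurableType d) (R : realType)
    (P : probability T R) (S A : set T) : measurable S -> measurable A ->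
  fine (P (S `&` ~` A)) = fine (P S) - fine (P (S `&` A)).
Proof.
move=> mS mA; rewrite -fineB ?fin_num_measure//; last exact: measurableI.
rewrite -measureD ?setDE// ltey_eq ?fin_num_measure//.
Qed.

(** * Joint law of the counts of finitely many types *)

Definition exact_draws (Omega : Type) (X : nat -> Omega -> nat)
    (js : seq nat) (l : nat -> nat) (n : nat) : set Omega :=
  [set w | forall j, j \in js -> times_drawn (X^~ w) j n = l j].

Lemma times_drawnS x j n :
  times_drawn x j n.+1 = (times_drawn x j n + (x n == j))%N.
Proof. by rewrite /times_drawn big_nat_recr. Qed.

(* For n < \sum l j the falling factorial vanishes, so the truncated subtraction
   in the exponent is harmless. *)
Definition multinomial_weight (R : realType) (p : nat -> R) (js : seq nat)
    (l : nat -> nat) (n : nat) : R :=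
  (n ^_ (\sum_(j <- js) l j))%:R * (\prod_(j <- js) (p j ^+ l j / (l j)`!%:R))
  * (1 - \sum_(j <- js) p j) ^+ (n - \sum_(j <- js) l j).

(** The counts still required of the earlier draws when the last draw has type [c]. The truncation
    only matters for [l c = 0], a case treated apart wherever this is used. *)
Definition decr_at (l : nat -> nat) (c : nat) : nat -> nat :=
  fun j => (l j - (c == j))%N.

Lemma multinomial_weight0 (R : realType) (p : nat -> R) js l :
  multinomial_weight R p js l 0 = (all (fun j => l j == 0)%N js)%:R.
Proof.
rewrite /multinomial_weight.
case: allP => [l0|nl0].
  rewrite big_seq (eq_bigr (fun=> 0%N)) => [|j /l0/eqP//].
  rewrite big1// !mul1r expr0 mulr1 big_seq big1// => j /l0/eqP ->.
  by rewrite expr0 fact0 divr1.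
rewrite (_ : 0 ^_ _ = 0)%N ?mul0r//; apply: ffact_small.
rewrite lt0n sum_nat_seq_eq0; apply/negP => /allP H.
by apply: nl0 => j /H; rewrite implyTb.
Qed.

(** This mirrors conditioning on the last draw: outside [js], or of some type [c] in [js]. The
    summands in [c] are [l c] times a common factor, so they add up to [L] times it; for L = k + 1
    the identity reduces to (n+1)^_(k+1) = n^_(k+1) + (k+1) n^_k. *)
Lemma multinomial_weightS (R : realType) (p : nat -> R) js l n : uniq js ->
  multinomial_weight R p js l n.+1 =
    (1 - \sum_(j <- js) p j) * multinomial_weight R p js l n
    + \sum_(c <- js) (if l c == 0%N then 0 else
         p c * multinomial_weight R p js (decr_at l c) n).
Proof.
move=> ujs; set q := 1 - _; set L := (\sum_(j <- js) l j)%N.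
set W := \prod_(j <- js) (p j ^+ l j / (l j)`!%:R).
have H c : c \in js -> (if l c == 0%N then 0 else
     p c * multinomial_weight R p js (decr_at l c) n) =
    (l c)%:R * ((n ^_ L.-1)%:R * W * q ^+ (n - L.-1)).
  move=> cjs; case: eqP => [->|/eqP lc0]; first by rewrite mul0r.
  have Lc : (\sum_(j <- js) decr_at l c j)%N = L.-1.
    rewrite /L !(bigD1_seq c)//= {1}/decr_at eqxx subn1.
    rewrite [in LHS](eq_bigr l) => [|j jc]; last by rewrite /decr_at eq_sym (negbTE jc) subn0.
    by case: (l c) lc0.
  rewrite /multinomial_weight Lc -/q.
  have -> : W = p c / (l c)%:R * \prod_(j <- js) (p j ^+ decr_at l c j / (decr_at l c j)`!%:R).
    rewrite /W !(bigD1_seq c)//= {1 2}/decr_at eqxx subn1.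
    under [in RHS]eq_bigr => j jc do rewrite /decr_at eq_sym (negbTE jc) subn0.
    case: (l c) lc0 => // k _ /=; rewrite factS natrM exprS.
    have : (k.+1%:R : R) != 0 by rewrite pnatr_eq0.
    have : (k`!%:R : R) != 0 by rewrite pnatr_eq0 -lt0n fact_gt0.
    by move=> ? ?; field; apply/andP; split.
  have : ((l c)%:R : R) != 0 by rewrite pnatr_eq0.
  by move=> ?; field.
rewrite big_seq (eq_bigr _ H) -big_seq -mulr_suml -natr_sum -/L.
rewrite /multinomial_weight -/L -/W -/q.
case: L {H} => [|k].
  by rewrite !ffactn0 !subn0 mul0r addr0 exprS /=; ring.
rewrite ffactSS ffactnSr subSS natrM /=.
(* With truncated subtraction, q q^(n-k-1) = q^(n-k) may fail when n <= k. There n^_k vanishes if n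
   < k, and the factor n - k vanishes if n = k. *)
have [nk|kn] := ltnP n k; first by rewrite ffact_small//; ring.
rewrite [in RHS]natrM.
have [->|/eqP nk] := eqVneq n k; first by rewrite subnn; ring.
have -> : (n - k = (n - k.+1).+1)%N by lia.
have -> : (n.+1 = (n - k.+1).+1 + k.+1)%N by lia.
by rewrite natrD exprS; ring.
Qed.

Lemma measurable_times_drawn d (T : measurableType d) (X : nat -> T -> nat) j n
    (c : nat) : (forall k c, measurable (X k @^-1` [set c])) ->
  measurable ((fun w => times_drawn (X^~ w) j n) @^-1` [set c]).
Proof.
move=> mX; elim: n c => [|n IH] c.
  have -> : (fun w => times_drawn (X^~ w) j 0) = cst 0%N.
    by apply/funext => w; rewrite /times_drawn big_nil.
  by rewrite preimage_cst; case: ifP.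
have -> : (fun w => times_drawn (X^~ w) j n.+1) @^-1` [set c] =
    ((fun w => times_drawn (X^~ w) j n) @^-1` [set c] `&` ~` (X n @^-1` [set j]))
    `|` (if c is c'.+1 then (fun w => times_drawn (X^~ w) j n) @^-1` [set c']
          `&` (X n @^-1` [set j]) else set0).
  apply/seteqP; split => w /=; rewrite times_drawnS.
    case: (eqVneq (X n w) j) => [Xj|/eqP Xj]; rewrite ?addn0 ?addn1 => <-; last by left.
    by right.
  case=> [[<- /eqP/negbTE ->]|]; first by rewrite addn0.
  by case: c => // c' [<- ->]; rewrite eqxx addn1.
apply: measurableU.
  by apply: measurableI => //; apply: measurableC.
by case: c => // c; exact: measurableI.
Qed.

Lemma measurable_exact_draws d (T : measurableType d) (X : nat -> T -> nat) js l n :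
  (forall k c, measurable (X k @^-1` [set c])) ->
  measurable (exact_draws T X js l n).
Proof.
move=> mX; elim: js => [|j js IH].
  by rewrite (_ : exact_draws _ _ _ _ _ = setT)//; apply/seteqP; split.
have -> : exact_draws T X (j :: js) l n =
    (fun w => times_drawn (X^~ w) j n) @^-1` [set l j] `&` exact_draws T X js l n.
  apply/seteqP; split => [w /= H|w /= [H1 H2] i].
    split; first by apply: H; exact: mem_head.
    by move=> i ijs; apply: H; rewrite inE ijs orbT.
  by rewrite inE => /orP[/eqP ->|/H2].
by apply: measurableI => //; exact: measurable_times_drawn.
Qed.

(* Intersecting with events on the draws of index >= n lets the induction on n
   condition on draw n while only using the product rule on cylinders. *)
Lemma exact_draws_law d (T : measurableType d) (R : realType)
    (P : probability T R) (N : nat) (p : nat -> R) (X : nat -> {RV P >-> nat})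
    (js : seq nat) (l : nat -> nat) (n : nat) (J : seq nat) (B : nat -> set nat) :
  coupon_draws N p X -> uniq js -> {in js, forall j, j < N}%N ->
  uniq J -> {in J, forall k, n <= k}%N ->
  fine (P (exact_draws T X js l n `&` \bigcap_(k in [set` J]) (X k @^-1` B k))) =
    multinomial_weight R p js l n * \prod_(k <- J) fine (P (X k @^-1` B k)).
Proof.
move=> [indep law] ujs jsN.
have mX k (A : set nat) : measurable (X k @^-1` A) by exact: measurable_funPTI.
have mcap K (C : nat -> set nat) :
    measurable (\bigcap_(k in [set` K : seq nat]) (X k @^-1` C k)).
  by apply: fin_bigcap_measurable => // k _.
elim: n l J B => [|n IH] l J B uJ Jn.
  rewrite multinomial_weight0; case: allP => [l0|l0].
    rewrite (_ : exact_draws _ _ _ _ _ = setT); last first.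
      by apply/seteqP; split => // w _ j /l0/eqP ->; rewrite /times_drawn big_nil.
    rewrite setTI mul1r indep//.
    rewrite (eq_bigr (fun k => (fine (P (X k @^-1` B k)))%:E)) => [|k _].
      by rewrite prodEFin.
    by rewrite fineK// fin_num_measure.
  rewrite (_ : exact_draws _ _ _ _ _ = set0) ?set0I ?measure0 ?mul0r//.
  apply/seteqP; split => // w /= H; apply: l0 => j /H.
  by rewrite /times_drawn big_nil => <-.
set C := \bigcap_(k in _) _.
(* Asking draw [n] to lie in [D] is one more cylinder condition, so the induction hypothesis applies
   with [n :: J] in place of [J]. *)
pose B' D k := if k == n then D else B k.
have nJ : n \notin J by apply/negP => /Jn; rewrite ltnn.
have capS D : \bigcap_(k in [set` n :: J]) (X k @^-1` B' D k) = X n @^-1` D `&` C.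
  apply/seteqP; split => [w H|w [H1 H2] k /=].
    split; first by have := H n (mem_head _ _); rewrite /B' /= eqxx.
    move=> k kJ; have := H k; rewrite /B' /= inE kJ orbT => /(_ isT).
    by case: eqP => // kn; move: nJ; rewrite -kn kJ.
  by rewrite /B' inE; case: eqP => [->//|_ /= kJ]; exact: H2.
have IHS D l' : fine (P (exact_draws T X js l' n `&` (X n @^-1` D `&` C))) =
    multinomial_weight R p js l' n * (fine (P (X n @^-1` D)) *
      \prod_(k <- J) fine (P (X k @^-1` B k))).
  rewrite -capS IH/= ?nJ//; last first.
    by move=> k; rewrite inE => /orP[/eqP ->//|/Jn]; exact: ltnW.
  rewrite big_cons /B' eqxx; congr (_ * (_ * _)).
  rewrite big_seq [RHS]big_seq; apply: eq_bigr => k kJ.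
  by case: eqP => // kn; move: nJ; rewrite -kn kJ.
have mE l' n' : measurable (exact_draws T X js l' n').
  by apply: measurable_exact_draws => k c; exact: mX.
set S := _ `&` C.
have mS : measurable S by apply: measurableI => //; exact: mcap.
(* Splitting [S] by whether draw [n] has a type in [js] produces the two terms of the recurrence for
   the weights. *)
have := @fine_measure_setIC _ _ _ P S (X n @^-1` [set` js]) mS (mX _ _).
move/eqP; rewrite eq_sym subr_eq => /eqP ->.
rewrite multinomial_weightS// mulrDl; congr (_ + _).
  have -> : S `&` ~` (X n @^-1` [set` js]) =
      exact_draws T X js l n `&` (X n @^-1` (~` [set` js]) `&` C).
    rewrite /S; apply/seteqP; split => w /=.
      move=> [[H ?] Xn]; split=> // j jjs; rewrite -(H j jjs) times_drawnS.
      by case: eqP => [Xj|_]; [case: Xn; rewrite Xj|rewrite addn0].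
    move=> [H [Xn ?]]; split => //; split=> // j jjs; rewrite times_drawnS.
    by case: eqP => [Xj|_]; [case: Xn; rewrite Xj|rewrite addn0 H].
  rewrite IHS mulrCA mulrA; congr (_ * _ * _).
  have := @fine_measure_setIC _ _ _ P setT (X n @^-1` [set` js]) measurableT (mX _ _).
  rewrite setTI probability_setT preimage_setC => ->; congr (_ - _).
  rewrite (fine_measure_preimage_seq _ _ _ P setT (X n) js)//.
  rewrite big_seq [RHS]big_seq; apply: eq_bigr => c cjs.
  by rewrite setTI law//; exact: jsN.
rewrite (fine_measure_preimage_seq _ _ _ P S (X n) js)// mulr_suml.
rewrite big_seq [RHS]big_seq; apply: eq_bigr => c cjs.
case: eqP => [lc0|/eqP lc0].
  rewrite (_ : S `&` _ = set0) ?measure0 ?mul0r//.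
  apply/seteqP; split => // w [[H _] /= Xc]; have := H c cjs.
  by rewrite times_drawnS Xc eqxx lc0 addn1.
have -> : S `&` X n @^-1` [set c] =
    exact_draws T X js (decr_at l c) n `&` (X n @^-1` [set c] `&` C).
  rewrite /S; apply/seteqP; split => w /=.
    move=> [[H ?] Xn]; split=> // j jjs; rewrite /decr_at -(H j jjs) times_drawnS.
    by rewrite Xn addnK.
  move=> [H [Xn ?]]; split => //; split=> // j jjs; rewrite times_drawnS H//.
  rewrite Xn /decr_at subnK//; case: eqP => // <-; rewrite lt0n//.
by rewrite IHS law//; [rewrite /=; ring|exact: jsN].
Qed.

(** * Binomial bounds and the Poisson limit *)

Lemma ffact_le_expn n k : (n ^_ k <= n ^ k)%N.
Proof.
elim: k => // k IH; rewrite ffactnSr expnSr; apply: leq_mul => //.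
exact: leq_subr.
Qed.

(** Binomial weights are compared with Poisson weights through n^_l <= n^l and 1 - q <= exp (- q).
    The window for [y] is the one met by y = a_j s when p_j = a_j / A_N and n is the integer part of
    s A_N. *)
Lemma multinomial_weight1_le (R : realType) (p : nat -> R) (j l m n : nat) (y : R) :
  0 <= p j <= 1 -> (l < m)%N -> n%:R * p j <= y <= n.+1%:R * p j ->
  multinomial_weight R p [:: j] (fun=> l) n <=
    expR m%:R * (y ^+ l / l`!%:R * expR (- y)).
Proof.
move=> /andP[p0 p1] lm /andP[ny yn].
have y0 : 0 <= y by apply: le_trans ny; rewrite mulr_ge0.
rewrite /multinomial_weight !big_seq1; set q := p j.
have rhs0 : 0 <= expR m%:R * (y ^+ l / l`!%:R * expR (- y)).
  by rewrite !mulr_ge0 ?expR_ge0 ?exprn_ge0 ?invr_ge0.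
have [nl|ln] := ltnP n l; first by rewrite ffact_small// !mul0r.
have H1 : (n ^_ l)%:R * (q ^+ l / l`!%:R) <= y ^+ l / l`!%:R.
  rewrite mulrA ler_wpM2r ?invr_ge0//.
  apply: (@le_trans _ _ ((n%:R * q) ^+ l)); last first.
    by apply: lerXn2r => //; rewrite nnegrE// mulr_ge0.
  rewrite exprMn ler_wpM2r ?exprn_ge0// -natrX ler_nat.
  exact: ffact_le_expn.
have H2 : (1 - q) ^+ (n - l) <= expR m%:R * expR (- y).
  apply: (@le_trans _ _ (expR (- q) ^+ (n - l))).
    apply: lerXn2r; rewrite ?nnegrE ?subr_ge0 ?expR_ge0//.
    exact: expR_ge1Dx.
  rewrite -expRM_natl -expRD ler_expR natrB//.
  (* Since y <= (n + 1) q, the exponent (n - l) q is at least y - (l + 1) q, hence at least y - m: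
     this is the origin of the factor exp m. *)
  have : l.+1%:R * q <= m%:R.
    apply: (@le_trans _ _ (l.+1%:R * 1)); first by rewrite ler_wpM2l.
    by rewrite mulr1 ler_nat.
  move: yn; rewrite -/q -!natr1; lra.
rewrite [leRHS]mulrCA; apply: ler_pM => //.
- by rewrite !mulr_ge0 ?exprn_ge0 ?invr_ge0.
- by rewrite exprn_ge0// subr_ge0.
Qed.

(** Poisson limit theorem for several types at once. With L the sum of the [l j] and S that of the
    [a j], the powers of a_j / A_N supply the A_N^L dividing the falling factorial, whose quotient
    tends to s^L; the remaining power of 1 - S / A_N tends to exp (- S s), which splits over
    [js]. *)
Lemma cvg_multinomial_weight (R : realType) (a A : nat -> R) (s : R)
    (js : seq nat) (l : nat -> nat) :
  0 <= s -> (forall j, 0 < a j) -> (forall N, (0 < N)%N -> 0 < A N) ->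
  (A N)^-1 @[N --> \oo] --> 0 ->
  multinomial_weight R (fun j => a j / A N) js l (Num.trunc (s * A N)) @[N --> \oo]
    --> \prod_(j <- js) ((a j * s) ^+ l j / (l j)`!%:R * expR (- (a j * s))).
Proof.
move=> s0 a0 A0 A_oo.
pose n N := Num.trunc (s * A N).
have nk k : (n N - k)%N%:R / A N @[N --> \oo] --> s.
  (* Rounding loses less than 1 and subtracting [k], even truncated, at most [k]; hence [k.+1]. *)
  apply: (@squeeze_cvgr _ _ _ _ (fun N => s - k.+1%:R * (A N)^-1) (cst s)).
  - near=> N; have AN : 0 < A N by apply: A0; near: N; exact: nbhs_infty_gt.
    rewrite /= ler_pdivlMr// mulrBl mulfVK ?gt_eqF// ler_pdivrMr//.
    have /truncn_itv/andP[n1 n2] : 0 <= s * A N by rewrite mulr_ge0// ltW.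
    rewrite -/(n N) in n1 n2; apply/andP; split.
      rewrite lerBlDr -natrD; apply: le_trans (ltW n2) _; rewrite ler_nat; lia.
    by apply: le_trans n1; rewrite ler_nat leq_subr.
  - rewrite -[X in _ --> X]subr0 -(mulr0 k.+1%:R).
    by apply: cvgB; [exact: cvg_cst|exact: cvgMr].
  - exact: cvg_cst.
have nff k : (n N ^_ k)%:R / A N ^+ k @[N --> \oo] --> s ^+ k.
  elim: k => [|k IH].
    under eq_fun do rewrite ffactn0 expr0 divr1; exact: cvg_cst.
  rewrite exprSr; apply: cvg_trans (cvgM IH (nk k)); apply: near_eq_cvg.
  by near=> N => /=; rewrite ffactnSr natrM exprSr invfM; ring.
set S := \sum_(j <- js) a j; set L := (\sum_(j <- js) l j)%N.
have S0 : 0 <= S by rewrite sumr_ge0// => j _; exact: ltW.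
have expS : (1 - S / A N) ^+ (n N - L) @[N --> \oo] --> expR (- (S * s)).
  have SA : 1 - S / A N @[N --> \oo] --> (1 : R).
    rewrite -[X in _ --> X]subr0 -(mulr0 S).
    by apply: cvgB; [exact: cvg_cst|exact: cvgMr].
  have kS : (n N - L)%N%:R * (S / A N) @[N --> \oo] --> S * s.
    apply: cvg_trans (cvgM (cvg_cst S) (nk L)); apply: near_eq_cvg.
    by near=> N => /=; ring.
  have kS' : (n N - L)%N%:R * (S / A N) / (1 - S / A N) @[N --> \oo] --> S * s.
    rewrite -[X in _ --> X]divr1; apply: cvgM => //.
    by apply: cvgV => //; exact: oner_neq0.
  (* exp (- y / (1 - y)) <= 1 - y <= exp (- y) *)
  apply: (@squeeze_cvgr _ _ _ _
    (fun N => expR (- ((n N - L)%N%:R * (S / A N) / (1 - S / A N))))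
    (fun N => expR (- ((n N - L)%N%:R * (S / A N))))).
  - near=> N.
    have lt0 : 0 < 1 - S / A N by near: N; exact: (cvgr_gt _ SA).
    rewrite -mulrA -[X in expR X]mulrN -[X in _ <= _ <= expR X]mulrN !expRM_natl.
    apply/andP; split; apply: lerXn2r; rewrite ?nnegrE ?expR_ge0 ?(ltW lt0)//.
      rewrite expRN -[leRHS]invrK lef_pV2 ?posrE ?expR_gt0 ?invr_gt0//.
      (* The lower bound is 1 + z <= exp z at z = y / (1 - y), because 1 / (1 - y) = 1 + y / (1 -
         y). *)
      apply: le_trans (expR_ge1Dx _).
      move: (S / A N) lt0 => y y1.
      by rewrite le_eqVlt; apply/orP; left; apply/eqP; field; rewrite gt_eqF.
    exact: expR_ge1Dx.
  - by apply: continuous_cvg; [exact: continuous_expR|exact: cvgN].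
  - by apply: continuous_cvg; [exact: continuous_expR|exact: cvgN].
have -> : \prod_(j <- js) ((a j * s) ^+ l j / (l j)`!%:R * expR (- (a j * s))) =
    s ^+ L * (\prod_(j <- js) (a j ^+ l j / (l j)`!%:R)) * expR (- (S * s)).
  rewrite big_split/= -expR_sum sumrN -mulr_suml; congr (_ * expR (- _)).
  rewrite /L; elim: js {S L S0 expS} => [|j js IH]; first by rewrite !big_nil mulr1.
  by rewrite !big_cons IH exprD exprMn; ring.
apply: cvg_trans (cvgM (cvgM (nff L) (cvg_cst (\prod_(j <- js) (a j ^+ l j / (l j)`!%:R)))) expS).
apply: near_eq_cvg; near=> N => /=.
rewrite /multinomial_weight -/L -mulr_suml -/S -/(n N); congr (_ * _).
rewrite -mulrA; congr (_ * _).
rewrite /L; elim: (js) => [|j js' IH]; first by rewrite !big_nil expr0 invr1 mul1r.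
by rewrite !big_cons -IH exprD invfM exprMn exprVn; ring.
Unshelve. all: by end_near.
Qed.

(** * Completion events and their limits for a fixed set of types *)

Definition at_least_draws (Omega : Type) (X : nat -> Omega -> nat)
    (m : nat) (bs : seq nat) (n : nat) : set Omega :=
  [set w | forall j, j \in bs -> (m <= times_drawn (X^~ w) j n)%N].

Lemma measurable_at_least_draws d (T : measurableType d) (X : nat -> T -> nat)
    m bs n : (forall k c, measurable (X k @^-1` [set c])) ->
  measurable (at_least_draws T X m bs n).
Proof.
move=> mX; elim: bs => [|j bs IH].
  by rewrite (_ : at_least_draws _ _ _ _ _ = setT)//; apply/seteqP; split.
have -> : at_least_draws T X m (j :: bs) n =
    (\bigcup_(c in [set c | m <= c]%N)
      (fun w => times_drawn (X^~ w) j n) @^-1` [set c]) `&` at_least_draws T X m bs n.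
  apply/seteqP; split => [w /= H|w /= [[c /= mc tc] H2] i].
    split; first by exists (times_drawn (X^~ w) j n) => //=; apply: H; exact: mem_head.
    by move=> i ijs; apply: H; rewrite inE ijs orbT.
  by rewrite inE => /orP[/eqP ->|/H2//]; rewrite tc.
apply: measurableI => //; apply: bigcup_measurable => c _.
exact: measurable_times_drawn.
Qed.

Lemma leq_times_drawn x j n n' : (n <= n')%N ->
  (times_drawn x j n <= times_drawn x j n')%N.
Proof.
move/subnK <-; elim: (n' - n)%N => // k IH.
by rewrite addSn times_drawnS (leq_trans IH)// leq_addr.
Qed.

(** An infimum at most s A lies strictly below the integer part of s A plus 1, so some admissible
    number of draws is at most that integer part; counts only grow with further draws. *)
Lemma collection_time_le (R : realType) (m N : nat) (x : nat -> nat) (A s : R) :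
  0 < A -> 0 <= s ->
  (collection_time R m N x * A^-1%:E <= s%:E)%E <->
  forall j, (j < N)%N -> (m <= times_drawn x j (Num.trunc (s * A)))%N.
Proof.
move=> A0 s0; rewrite lee_pdivrMr// -EFinM.
have /truncn_itv/andP[t1 t2] : 0 <= s * A by rewrite mulr_ge0// ltW.
split => [le_T|H].
  have /ereal_inf_lt[_ [n nS <-]] :
      (collection_time R m N x < (Num.trunc (s * A)).+1%:R%:E)%E.
    by apply: le_lt_trans le_T _; rewrite lte_fin.
  rewrite lte_fin ltr_nat ltnS => nt j /nS; move/leq_trans; apply.
  exact: leq_times_drawn.
apply: ge_ereal_inf; exists (Num.trunc (s * A))%:R%:E; last by rewrite lee_fin.
by exists (Num.trunc (s * A)).
Qed.

(* The exact counts on [js] are there for the induction on [bs]: the event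
   "count of b >= m" is the complement of the events "count of b = i", i < m. *)
Lemma cvg_at_least_draws (R : realType) (m : nat) (a A : nat -> R)
    (d : nat -> measure_display) (Omega : forall N : nat, measurableType (d N))
    (P : forall N : nat, probability (Omega N) R)
    (X : forall N : nat, nat -> {RV (P N) >-> nat}) (s : R)
    (js bs : seq nat) (l : nat -> nat) :
  0 <= s -> (forall j, 0 < a j) -> (forall N, (0 < N)%N -> 0 < A N) ->
  (A N)^-1 @[N --> \oo] --> 0 ->
  (forall N, (0 < N)%N -> coupon_draws N (fun j => a j / A N) (X N)) ->
  uniq (js ++ bs) ->
  fine (P N (exact_draws _ (X N) js l (Num.trunc (s * A N)) `&`
             at_least_draws _ (X N) m bs (Num.trunc (s * A N)))) @[N --> \oo]
  --> \prod_(j <- js) ((a j * s) ^+ l j / (l j)`!%:R * expR (- (a j * s))) *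
      \prod_(j <- bs) (1 - exp_sum m (a j * s) * expR (- (a j * s))).
Proof.
move=> s0 a0 A0 A_oo hX.
elim: bs js l => [|b bs IH] js l.
  rewrite cats0 big_nil mulr1 => ujs.
  have := cvg_multinomial_weight R a A s js l s0 a0 A0 A_oo.
  apply: cvg_trans; apply: near_eq_cvg; near=> N => /=.
  (* [coupon_draws] prescribes the probabilities of types below [N] only, so [N] must exceed every
     element of [js]. *)
  have jsN : {in js, forall j, j < N}%N.
    move=> j jjs; apply: leq_ltn_trans (@leq_bigmax_seq nat js xpredT id j jjs isT) _.
    by near: N; exact: nbhs_infty_gt.
  have N0 : (0 < N)%N by near: N; exact: nbhs_infty_gt.
  have := @exact_draws_law _ _ _ _ _ _ _ js l (Num.trunc (s * A N)) [::] (fun=> setT)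
    (hX N N0) ujs jsN isT (fun k => ltac:(by [])).
  rewrite big_nil mulr1 => <-; congr (fine (P N (_ `&` _))).
  by apply/seteqP; split.
move=> ubs.
have ubs1 : uniq (js ++ bs).
  by move: ubs; rewrite -cat_rcons -cats1 -catA !cat_uniq /= => /and3P[-> /norP[_ ->] /andP[_ ->]].
have ubs2 : uniq ((b :: js) ++ bs) by rewrite cat_cons -cat1s uniq_catCA.
have bjs : b \notin js by move: ubs2 => /= /andP[]; rewrite mem_cat => /norP[].
(* Moves [b] from [bs] to the types with exact counts, with count [i]. *)
pose up i j := if j == b then i else l j.
have lim : fine (P N (exact_draws _ (X N) js l (Num.trunc (s * A N)) `&`
             at_least_draws _ (X N) m bs (Num.trunc (s * A N)))) -
    \sum_(i <- index_iota 0 m)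
     fine (P N (exact_draws _ (X N) (b :: js) (up i) (Num.trunc (s * A N)) `&`
             at_least_draws _ (X N) m bs (Num.trunc (s * A N)))) @[N --> \oo] -->
    \prod_(j <- js) ((a j * s) ^+ l j / (l j)`!%:R * expR (- (a j * s))) *
      \prod_(j <- bs) (1 - exp_sum m (a j * s) * expR (- (a j * s))) -
    \sum_(i <- index_iota 0 m)
      (\prod_(j <- b :: js) ((a j * s) ^+ up i j / (up i j)`!%:R * expR (- (a j * s))) *
      \prod_(j <- bs) (1 - exp_sum m (a j * s) * expR (- (a j * s)))).
  apply: cvgB; first exact: IH.
  by apply: cvg_big => [|i _]; [exact: add_continuous|exact: IH].
set rhs := (X in _ --> X); set rhs' := (X in _ --> X) in lim.
(* The subtracted terms share the products over [js] and [bs]; their Poisson weights at [b] add up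
   to [exp_sum m (a b * s) * expR (- (a b * s))], which leaves the factor of [b]. *)
have <- : rhs' = rhs.
  rewrite /rhs /rhs' big_cons {2}/exp_sum mulr_suml.
  set PB := \prod_(j <- bs) _; set PJ := \prod_(j <- js) _.
  rewrite mulrCA mulrBl mul1r mulr_suml; congr (_ - _); apply: eq_bigr => i _.
  rewrite big_cons mulrA {1 2}/up eqxx; congr (_ * _ * _).
  rewrite /PJ big_seq [RHS]big_seq; apply: eq_bigr => j jjs; rewrite /up.
  by case: eqP => // jb; move: bjs; rewrite -jb jjs.
apply: cvg_trans lim; apply: near_eq_cvg; near=> N => /=.
set n := Num.trunc _.
have mX k (c : nat) : measurable (X N k @^-1` [set c]) by exact: measurable_funPTI.
have mS : measurable (exact_draws _ (X N) js l n `&` at_least_draws _ (X N) m bs n).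
  by apply: measurableI; [exact: measurable_exact_draws|exact: measurable_at_least_draws].
have mt c : measurable ((fun w => times_drawn (X N ^~ w) b n) @^-1` [set c]).
  exact: measurable_times_drawn.
rewrite (eq_bigr (fun i => fine (P N ((exact_draws _ (X N) js l n `&`
    at_least_draws _ (X N) m bs n) `&`
    (fun w => times_drawn (X N ^~ w) b n) @^-1` [set i])))); last first.
  move=> i _; congr (fine (P N _)); apply/seteqP; split => w /=.
    move=> [H ?]; split; last by rewrite H ?mem_head// /up eqxx.
    split => // j jjs; rewrite H ?inE ?jjs ?orbT// /up.
    by case: eqP => // jb; move: bjs; rewrite -jb jjs.
  move=> [[H ?] tb]; split => // j; rewrite inE /up => /orP[/eqP ->|jjs].
    by rewrite eqxx.
  case: eqP => [-> //|_]; exact: H.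
rewrite -fine_measure_preimage_seq//; last exact: iota_uniq.
rewrite -fine_measure_setIC//; last first.
  rewrite [X in measurable X](_ : _ = \bigcup_(c in [set c | c < m]%N)
     (fun w => times_drawn (X N ^~ w) b n) @^-1` [set c]).
    by apply: bigcup_measurable => c _.
  apply/seteqP; split => w /=; rewrite mem_index_iota; first by exists (times_drawn (X N ^~ w) b n).
  by move=> [c /= cm /= ->].
congr (fine (P N _)); apply/seteqP; split => w /=; rewrite mem_index_iota /=.
  move=> [[H1 H2] /negP]; rewrite -leqNgt => H3; split => // j.
  by rewrite inE => /orP[/eqP ->|/H2].
move=> [H1 H2]; split.
  by split => // j jbs; apply: H2; rewrite inE jbs orbT.
by apply/negP; rewrite -leqNgt; apply: H2; rewrite mem_head.
Unshelve. all: by end_near.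
Qed.

(** * Divergence of the integral of 1/x at 0 *)

Lemma integral_inv_itv01 (R : realType) :
  (\int[@lebesgue_measure R]_(x in `]0%R, 1%R[) (x^-1)%:E)%E = +oo%E.
Proof.
have mI (A : set R) : measurable A -> A `<=` [set x | 0 < x] ->
    measurable_fun A (fun x : R => (x^-1)%:E).
  move=> mA A0; apply/measurable_EFinP.
  apply: (@measurable_funS _ _ R _ [set x : R | 0 < x]).
    by rewrite -set_itvoy; exact: measurable_itv.
    exact: A0.
  apply: open_continuous_measurable_fun; first exact: open_gt.
  by move=> x; rewrite inE/= => x0; apply: inv_continuous; rewrite gt_eqF.
apply/eqP; rewrite eq_le leey/= leNgt; apply/negP => Ioo.
set I := (X in (X < _)%E) in Ioo.
have I0 : (0 <= I)%E.
  by apply: integral_ge0 => x /=; rewrite in_itv/= lee_fin invr_ge0 => /andP[/ltW].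
(* The primitive [ln] gives the value M between exp (- M) and 1; M = r + 1 then rules out a finite
   value r. *)
suff H M : 0 < M -> (M%:E <= I)%E.
  move: I0 Ioo H; case: I => [r|//|//] r0 _ /(_ (r + 1)).
  rewrite lee_fin gerDl ler10 => H; suff: false by []; apply: H.
  by rewrite ltr_wpDl// -lee_fin.
move=> M0.
have e1 : expR (- M) < 1 by rewrite expR_lt1 oppr_lt0.
have e0 := @expR_gt0 R (- M).
have <- : (\int[@lebesgue_measure R]_(x in `[expR (- M), 1%R]) (x^-1)%:E)%E = M%:E.
  rewrite (@continuous_FTC2 _ _ (@ln R))//.
  - by rewrite ln1 expRK -EFinB sub0r opprK.
  - apply: continuous_in_subspaceT => x; rewrite inE/= in_itv/= => /andP[ex _].
    by apply: inv_continuous; rewrite gt_eqF// (lt_le_trans e0).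
  - split.
    + move=> x; rewrite in_itv/= => /andP[ex _].
      by have [] := is_derive1_ln (lt_trans e0 ex).
    + by apply: cvg_at_right_filter; exact: continuous_ln.
    + by apply: cvg_at_left_filter; apply: continuous_ln.
  - move=> x; rewrite in_itv/= => /andP[ex _]; rewrite derive1E.
    by have [_ ->] := is_derive1_ln (lt_trans e0 ex).
(* The fundamental theorem is used on a closed interval, whereas [I] omits the endpoint 1; it is
   dropped before the domains are compared. *)
rewrite -integral_itv_bndo_bndc; last first.
  by apply: mI => // x /=; rewrite in_itv/= => /andP[+ _]; exact: lt_le_trans.
apply: ge0_subset_integral => //.
- by apply: mI => // x /=; rewrite in_itv/= => /andP[].
- by move=> x /=; rewrite in_itv/= lee_fin invr_ge0 => /andP[/ltW].
- by move=> x /=; rewrite !in_itv/= => /andP[/(lt_le_trans e0) -> ->].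
Qed.

(** * Poisson tails, infinite products and the growth of A_N *)

Lemma exp_sum_ge1 (R : realType) m (y : R) : (0 < m)%N -> 0 <= y -> 1 <= exp_sum m y.
Proof.
move=> m0 y0; rewrite /exp_sum big_ltn// expr0 fact0 divr1 lerDl.
by apply: sumr_ge0 => l _; rewrite mulr_ge0 ?exprn_ge0 ?invr_ge0.
Qed.

Lemma exp_sum_le_expR (R : realType) m (y : R) : 0 <= y -> exp_sum m y <= expR y.
Proof.
move=> y0; apply: (@nondecreasing_cvgn_le _ (series (exp_coeff y))).
  by apply: nondecreasing_series => n _ _; rewrite /exp_coeff /= mulr_ge0 ?exprn_ge0 ?invr_ge0.
exact: is_cvg_series_exp_coeff.
Qed.

(** The quantity is the probability that a Poisson variable of mean [y] is below [m]. The bounds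
    make it a legitimate [u j] in the product lemmas that follow. *)
Lemma exp_sum_mul_expRN_itv (R : realType) m (y : R) : 0 <= y ->
  0 <= exp_sum m y * expR (- y) <= 1.
Proof.
move=> y0; rewrite mulr_ge0 ?expR_ge0//=; last first.
  by rewrite /exp_sum sumr_ge0 //= => l _; rewrite mulr_ge0 ?exprn_ge0 ?invr_ge0.
by rewrite expRN ler_pdivrMr ?expR_gt0// mul1r exp_sum_le_expR.
Qed.

Lemma prod_onem_ge0 (R : realType) (u : nat -> R) n :
  (forall j, 0 <= u j <= 1) -> 0 <= \prod_(0 <= j < n) (1 - u j).
Proof.
by move=> u01; apply: prodr_ge0 => j _; have /andP[_ ?] := u01 j; rewrite subr_ge0.
Qed.

Lemma nonincreasing_prod_onem (R : realType) (u : nat -> R) :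
  (forall j, 0 <= u j <= 1) ->
  nonincreasing_seq (fun n => \prod_(0 <= j < n) (1 - u j)).
Proof.
move=> u01; apply/nonincreasing_seqP => n; rewrite big_nat_recr//=.
by rewrite ler_piMr ?prod_onem_ge0//; have /andP[? _] := u01 n; rewrite gerBl.
Qed.

Lemma cvg_infinite_prod (R : realType) (u : nat -> R) :
  (forall j, 0 <= u j <= 1) ->
  \prod_(0 <= j < n) (1 - u j) @[n --> \oo] --> infinite_prod (fun j => 1 - u j).
Proof.
move=> u01; apply: nonincreasing_is_cvgn; first exact: nonincreasing_prod_onem.
by exists 0 => _ [n _ <-]; exact: prod_onem_ge0.
Qed.

Lemma infinite_prod_le (R : realType) (u : nat -> R) n :
  (forall j, 0 <= u j <= 1) ->
  infinite_prod (fun j => 1 - u j) <= \prod_(0 <= j < n) (1 - u j).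
Proof.
move=> u01; apply: (nonincreasing_cvgn_ge (nonincreasing_prod_onem _ _ u01)).
exact: cvgP (cvg_infinite_prod _ _ u01).
Qed.

Lemma infinite_prod_ge0 (R : realType) (u : nat -> R) :
  (forall j, 0 <= u j <= 1) -> 0 <= infinite_prod (fun j => 1 - u j).
Proof.
move=> u01; apply: limr_ge; first exact: cvgP (cvg_infinite_prod _ _ u01).
by apply: nearW => n; exact: prod_onem_ge0.
Qed.

(** From 1 - u <= exp (- u), the product is at most exp of minus any partial sum, so minus the
    logarithm of the product bounds all partial sums. *)
Lemma infinite_prod_gt0_is_cvg_series (R : realType) (u : nat -> R) :
  (forall j, 0 <= u j <= 1) -> 0 < infinite_prod (fun j => 1 - u j) ->
  cvgn (series u).
Proof.
move=> u01 F0; apply: nondecreasing_is_cvgn.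
  by apply: nondecreasing_series => n _ _; have /andP[] := u01 n.
exists (- ln (infinite_prod (fun j => 1 - u j))) => _ [n _ <-].
rewrite lerNr -ler_expR lnK ?posrE//.
apply: (le_trans (infinite_prod_le _ _ n u01)).
rewrite /series /= -sumrN expR_sum; apply: ler_prod => j _.
by have /andP[_ ?] := u01 j; rewrite subr_ge0; apply/andP; split => //; exact: expR_ge1Dx.
Qed.

(* If all the products vanished, the integrand of [L1] would be 1/x. *)
Lemma L1_lty_infinite_prod_gt0 (R : realType) (a : nat -> R) (m : nat) :
  (forall j, 0 < a j) -> (L1 a m < +oo)%E ->
  exists2 t, 0 < t & 0 < limit_cdf a m t.
Proof.
move=> a0; apply: contraPP => H; apply/negP; rewrite -leNgt.
rewrite [leRHS](_ : _ = (\int[@lebesgue_measure R]_(x in `]0%R, 1%R[) (x^-1)%:E)%E).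
  by rewrite integral_inv_itv01.
apply: eq_integral => x; rewrite inE/= in_itv/= => /andP[x0 x1].
congr (_%:E); rewrite -[RHS]mul1r; congr (_ * _).
have lnx : 0 < - ln x by rewrite oppr_gt0 ln_lt0// x0.
(* Under t = - ln x the power x^(a_j) becomes exp (- a_j t), so the product is F(t), which [H]
   forces to be 0. *)
have -> : infinite_prod
    (fun j => 1 - x `^ a j * exp_sum m (- a j * ln x)) = limit_cdf a m (- ln x).
  congr infinite_prod; apply/funext => j; congr (_ - _).
  by rewrite mulrC mulNr mulrN opprK /powR gt_eqF.
have : 0 <= limit_cdf a m (- ln x).
  apply: (@infinite_prod_ge0 _ (fun j => exp_sum m (a j * - ln x) * expR (- (a j * - ln x)))).
  by move=> j; apply: exp_sum_mul_expRN_itv; rewrite mulr_ge0 ?ltW.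
rewrite le_eqVlt => /orP[/eqP <-|]; first by rewrite subr0.
by move=> F0; exfalso; apply: H; exists (- ln x).
Qed.

(** Positivity of F(t) makes the tails [u j] summable, so they tend to 0. As S_m >= 1, exp (- a_j t)
    <= u_j, which forces a_j > 1 eventually and at least linear growth of the partial sums. *)
Lemma cvg_partial_sumV (R : realType) (a : nat -> R) (m : nat) (t : R) :
  (0 < m)%N -> (forall j, 0 < a j) -> 0 < t -> 0 < limit_cdf a m t ->
  (partial_sum a N)^-1 @[N --> \oo] --> 0.
Proof.
move=> m0 a0 t0 F0.
pose u j := exp_sum m (a j * t) * expR (- (a j * t)).
have at0 j : 0 <= a j * t by rewrite mulr_ge0 ?ltW.
have u01 j : 0 <= u j <= 1 by exact: exp_sum_mul_expRN_itv.
have u_0 := cvg_series_cvg_0 (infinite_prod_gt0_is_cvg_series _ _ u01 F0).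
have [M _ aM] : \forall j \near \oo, 1 < a j.
  (* The threshold is the value of exp (- a t) at a = 1. *)
  have : \forall j \near \oo, u j < expR (- t).
    exact: (cvgr_lt _ u_0 _ (expR_gt0 _)).
  apply: filterS => j; rewrite /u => uj.
  have : expR (- (a j * t)) < expR (- t).
    by apply: le_lt_trans uj; rewrite ler_peMl ?expR_ge0// exp_sum_ge1.
  by rewrite ltr_expR ltrN2 -[ltLHS]mul1r ltr_pM2r.
apply/gtr0_cvgV0.
  near=> N; have N0 : (0 < N)%N by near: N; exact: nbhs_infty_gt.
  rewrite /partial_sum big_ltn// ltr_pwDl// sumr_ge0// => j _; exact: ltW.
apply/cvgryPge => B; near=> N.
have MN : (M + (Num.trunc B).+1 <= N)%N by near: N; exact: nbhs_infty_ge.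
have MN' : (M <= N)%N by apply: leq_trans MN; exact: leq_addr.
rewrite /partial_sum (big_cat_nat (n := M))//=.
apply: (@le_trans _ _ (\sum_(M <= j < N) a j)); last first.
  by rewrite lerDr sumr_ge0// => j _; exact: ltW.
apply: (@le_trans _ _ (\sum_(M <= j < N) 1)); last first.
  by apply: ler_sum_nat => j /andP[Mj _]; apply: ltW; exact: aM.
rewrite sumr_const_nat; apply: (@le_trans _ _ (Num.trunc B).+1%:R).
  by apply/ltW/truncnS_gt.
by rewrite ler_nat; lia.
Unshelve. all: by end_near.
Qed.

(** * Union bound and convergence in distribution *)

Lemma few_draws_le d (T : measurableType d) (R : realType)
    (P : probability T R) (N : nat) (p : nat -> R) (X : nat -> {RV P >-> nat})
    (j m n : nat) (y : R) :
  coupon_draws N p X -> (j < N)%N -> 0 <= p j <= 1 ->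
  n%:R * p j <= y <= n.+1%:R * p j ->
  fine (P [set w | times_drawn (X ^~ w) j n \in index_iota 0 m]) <=
    expR m%:R * (exp_sum m y * expR (- y)).
Proof.
move=> hX jN p01 y_itv.
have mX k (c : nat) : measurable (X k @^-1` [set c]) by exact: measurable_funPTI.
have mt c : measurable ((fun w => times_drawn (X ^~ w) j n) @^-1` [set c]).
  exact: measurable_times_drawn.
(* Each count l < m contributes one single-type weight, compared termwise with the sum defining
   [exp_sum]. *)
rewrite -[X in P X]setTI (fine_measure_preimage_seq _ _ _ P setT _ _)//; last exact: iota_uniq.
rewrite /exp_sum mulr_suml mulr_sumr big_seq [leRHS]big_seq.
apply: ler_sum => l; rewrite mem_index_iota => /= lm.
apply: le_trans (multinomial_weight1_le R p j l m n y p01 lm y_itv).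
have jN' : {in [:: j], forall i, i < N}%N by move=> i; rewrite inE => /eqP ->.
have := @exact_draws_law _ _ _ _ _ _ _ [:: j] (fun=> l) n [::] (fun=> setT)
  hX isT jN' isT (fun k => ltac:(by [])).
rewrite big_nil mulr1 => <-; rewrite le_eqVlt; apply/orP; left; apply/eqP.
congr (fine (P _)); apply/seteqP; split => w /=.
  by move=> [_ tl]; split => // i; rewrite inE => /eqP ->.
by move=> [H _]; split => //; apply: H; rewrite inE.
Qed.

(** One step of the union bound: if all types below [K] are complete, either type [K] is complete
    too or it falls short of [m]. *)
Lemma at_least_drawsS_ge d (T : measurableType d) (R : realType)
    (P : probability T R) (X : nat -> {RV P >-> nat}) (m K n : nat) :
  fine (P (at_least_draws T X m (iota 0 K) n)) -
    fine (P [set w | times_drawn (X ^~ w) K n \in index_iota 0 m]) <=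
  fine (P (at_least_draws T X m (iota 0 K.+1) n)).
Proof.
have mX k (c : nat) : measurable (X k @^-1` [set c]) by exact: measurable_funPTI.
have mG K' : measurable (at_least_draws T X m (iota 0 K') n).
  exact: measurable_at_least_draws.
have mt : measurable [set w | times_drawn (X ^~ w) K n \in index_iota 0 m].
  rewrite [X in measurable X](_ : _ = \bigcup_(c in [set c | c < m]%N)
     (fun w => times_drawn (X ^~ w) K n) @^-1` [set c]).
    by apply: bigcup_measurable => c _; exact: measurable_times_drawn.
  apply/seteqP; split => w /=; rewrite mem_index_iota.
    by exists (times_drawn (X ^~ w) K n).
  by move=> [c /= cm /= ->].
rewrite lerBlDr -fineD ?fin_num_measure// fine_le ?fin_numD ?fin_num_measure//.
apply: le_trans (measureU2 _ _ _) => //.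
apply: le_measure; rewrite ?inE//; first exact: measurableU.
move=> w H; case: (ltnP (times_drawn (X ^~ w) K n) m) => tK.
  by right; have : times_drawn (X ^~ w) K n \in index_iota 0 m by rewrite mem_index_iota.
left => j; rewrite mem_iota /= ltnS leq_eqVlt => /orP[/eqP -> //|jK].
by apply: H; rewrite mem_iota.
Qed.

Theorem theorem4p1 (R : realType) (m : nat) (hm : (0 < m)%N)
  (a : nat -> R) (ha : forall j, 0 < a j)
  (hL : (L1 a m < +oo)%E)
  (d : nat -> measure_display)
  (Omega : forall N : nat, measurableType (d N))
  (P : forall N : nat, probability (Omega N) R)
  (X : forall N : nat, nat -> {RV (P N) >-> nat})
  (hX : forall N : nat, (0 < N)%N ->
    coupon_draws N (fun j => a j / partial_sum a N) (X N))
  (s : R) (hs : 0 <= s) :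
  (fun N : nat =>
     P N [set w | (collection_time R m N (fun k => X N k w)
                     * (partial_sum a N)^-1%:E <= s%:E)%E])
    @ \oo --> (limit_cdf a m s)%:E.
Proof.
set A := partial_sum a.
have A0 N : (0 < N)%N -> 0 < A N.
  move=> N0; rewrite /A /partial_sum big_ltn// ltr_pwDl// sumr_ge0// => j _.
  exact: ltW.
have A_oo : (A N)^-1 @[N --> \oo] --> 0.
  have [t t0 Ft0] := L1_lty_infinite_prod_gt0 _ _ _ ha hL.
  exact: cvg_partial_sumV hm ha t0 Ft0.
pose n N := Num.trunc (s * A N).
(* Two parameters: the limit in [N] is taken at fixed [K], and [K] is chosen according to the
   tolerance. The event of the theorem is the diagonal [G N N]. *)
pose G N K := at_least_draws _ (X N) m (iota 0 K) (n N).
have mG N K : measurable (G N K).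
  by apply: measurable_at_least_draws => k c; exact: measurable_funPTI.
pose u j := exp_sum m (a j * s) * expR (- (a j * s)).
have u01 j : 0 <= u j <= 1 by apply: exp_sum_mul_expRN_itv; rewrite mulr_ge0// ltW.
pose F K := \prod_(0 <= j < K) (1 - u j).
have F_cvg : F K @[K --> \oo] --> limit_cdf a m s by exact: cvg_infinite_prod.
have GF K : fine (P N (G N K)) @[N --> \oo] --> F K.
  have := @cvg_at_least_draws R m a A d Omega P X s [::] (iota 0 K) (fun=> 0%N)
    hs ha A0 A_oo hX (iota_uniq _ _).
  rewrite big_nil mul1r /F /index_iota subn0; apply: cvg_trans.
  apply: near_eq_cvg; near=> N; congr (fine (P N _)).
  by apply/seteqP; split => [w []//|w ?]; split.
have G_le N K : (K <= N)%N -> fine (P N (G N N)) <= fine (P N (G N K)).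
  move=> KN; apply: fine_le; rewrite ?fin_num_measure//.
  apply: le_measure; rewrite ?inE// => w H j; rewrite mem_iota => /= jK.
  by apply: H; rewrite mem_iota/= (leq_trans jK).
have G_ge N K : (K <= N)%N -> fine (P N (G N K)) - expR m%:R * \sum_(K <= j < N) u j
    <= fine (P N (G N N)).
  (* Types are added one at a time from [K] on, type j costing at most exp m times [u j]. *)
  move=> KN; suff H i : (K + i <= N)%N ->
      fine (P N (G N K)) - expR m%:R * \sum_(K <= j < K + i) u j
        <= fine (P N (G N (K + i)%N)) by have := H (N - K)%N; rewrite subnKC//; exact.
  elim: i => [_|i IH]; first by rewrite addn0 big_geq// mulr0 subr0.
  rewrite addnS => KiN; apply: le_trans (at_least_drawsS_ge _ _ _ _ _ _ _ _).
  rewrite big_nat_recr ?leq_addr//= mulrDr opprD addrA lerB//; first exact: IH (ltnW KiN).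
  have N0 : (0 < N)%N by exact: leq_ltn_trans KiN.
  have AN := A0 N N0.
  apply: (few_draws_le _ _ _ _ N (fun j => a j / A N)) => //; first exact: hX.
    rewrite divr_ge0 ?(ltW (ha _)) ?(ltW AN)//= ler_pdivrMr// mul1r /A /partial_sum.
    rewrite (bigD1_seq (K + i)%N) ?mem_index_iota ?iota_uniq//= lerDl.
    by apply: sumr_ge0 => j _; exact: ltW.
  (* Dividing n <= s A_N < n + 1 by A_N and multiplying by a_j gives the window required of y = a_j
     s. *)
  have /truncn_itv/andP[t1 t2] : 0 <= s * A N by rewrite mulr_ge0// ltW.
  rewrite !mulrA ler_pdivrMr// ler_pdivlMr// -/(n N).
  have aKi := ha (K + i)%N.
  rewrite -[X in _ <= X <= _]mulrA [X in _ <= X <= _]mulrC.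
  by rewrite !ler_pM2r//; apply/andP; split => //; exact: ltW.
have q_cvg : fine (P N (G N N)) @[N --> \oo] --> limit_cdf a m s.
  apply/cvgrPdist_lt => e e0.
  have F0 : 0 <= limit_cdf a m s by exact: infinite_prod_ge0.
  have lower : \forall N \near \oo, limit_cdf a m s - e < fine (P N (G N N)).
    (* F(s) = 0 does occur, for instance at s = 0, and the [u j] need not be summable then;
       nonnegativity of probabilities suffices in that case. *)
    move: F0; rewrite le_eqVlt => /orP[/eqP <-|F0].
      by near=> N; rewrite sub0r (@lt_le_trans _ _ 0) ?oppr_lt0// fine_ge0.
    (* Union bound: types j >= K are missed with probability O(\sum_(j >= K) u j). *)
    have u_cvg := infinite_prod_gt0_is_cvg_series _ _ u01 F0.
    have u_nd : {homo series u : k l / (k <= l)%N >-> k <= l}.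
      by apply: nondecreasing_series => k _ _; have /andP[] := u01 k.
    (* Half of [e] pays for the tail after multiplication by exp m, the other half for the
       convergence of [G N K] at this fixed [K]. *)
    have e1 : 0 < e / 2 / expR m%:R by rewrite !divr_gt0// expR_gt0.
    have [K _ /(_ K (leqnn K))/= uK] :
        \forall K \near \oo, limn (series u) - e / 2 / expR m%:R < series u K.
      by apply: (cvgr_gt _ u_cvg); rewrite ltrBlDr ltrDl.
    have FK : limit_cdf a m s <= F K by exact: infinite_prod_le.
    near=> N; have KN : (K <= N)%N by near: N; exact: nbhs_infty_ge.
    apply: lt_le_trans (G_ge N K KN).
    have : F K - e / 2 < fine (P N (G N K)).
      by near: N; apply: (cvgr_gt _ (GF K)); rewrite ltrBlDr ltrDl divr_gt0.
    have : expR m%:R * \sum_(K <= j < N) u j <= e / 2.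
      rewrite mulrC -ler_pdivlMr ?expR_gt0//.
      have -> : \sum_(K <= j < N) u j = series u N - series u K.
        by rewrite /series /= (big_cat_nat (m := 0%N) (n := K) (p := N))//= addrAC subrr add0r.
      by have := nondecreasing_cvgn_le u_nd u_cvg N; move: uK; lra.
    by move: FK; lra.
  (* For the upper bound, [G N N] is contained in [G N K], whose probability tends to F_K(s) < F(s)
     + e. *)
  have [K _ /(_ K (leqnn K))/= FK] : \forall K \near \oo, F K < limit_cdf a m s + e.
    by apply: (cvgr_lt _ F_cvg); rewrite ltrDl.
  near=> N; rewrite ltr_distlC; apply/andP; split; first by near: N; exact: lower.
  apply: le_lt_trans (G_le N K _) _; first by near: N; exact: nbhs_infty_ge.
  by near: N; exact: (cvgr_lt _ (GF K)).
(* At N = 0 the normalisation [A N] is the empty sum 0, so the events are identified for positive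
   [N] only, which is enough for the limit. *)
have TG N : (0 < N)%N -> [set w | (collection_time R m N (fun k => X N k w)
    * (A N)^-1%:E <= s%:E)%E] = G N N.
  move=> N0; apply/seteqP; split => w.
    move/(collection_time_le _ _ _ _ _ _ (A0 N N0) hs) => Tw j.
    by rewrite mem_iota => /Tw.
  move=> Gw; apply/(collection_time_le _ _ _ _ _ _ (A0 N N0) hs) => j jN.
  by apply: Gw; rewrite mem_iota.
apply: cvg_EFin.
  near=> N; rewrite TG ?fin_num_measure//; near: N; exact: nbhs_infty_gt.
apply: cvg_trans q_cvg; apply: near_eq_cvg; near=> N => /=.
rewrite TG//; near: N; exact: nbhs_infty_gt.
Unshelve. all: by end_near.
Qed.
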